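(* There exist $\varepsilon>0$ and a path of Borel probability measures $(\mu_t)_{t\in(-\varepsilon,\varepsilon)}$ on $\mathbb{S}^1$ with $\mu_0=\lambda$, continuous in the weak topology, with $\mu_t$ atomless for almost all $t$, such that: $$\frac{\mathrm{d}}{\mathrm{d}t}\int_{\mathbb{S}^1}\psi_0\,\mathrm{d}\mu_t\Big\rvert_{t=0}\neq0$$ for some smooth function $\psi_0:\mathbb{S}^1\to\mathbb{R}$, and $$\frac{\mathrm{d}}{\mathrm{d}t}\int_{\mathbb{S}^1}\psi\,\mathrm{d}\mu_t\Big\rvert_{t=0}=\frac{\mathrm{d}}{\mathrm{d}t}\int_{\mathbb{S}^1}\psi\,\mathrm{d}\big(\Phi_{d\#}\mu_t\big)\Big\rvert_{t=0}$$ for all smooth functions $\psi:\mathbb{S}^1\to\mathbb{R}$ and all integers $d\geqslant2$ (where all these derivatives exist).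
   Context: $\mathbb{S}^1=\mathbb{R}/\mathbb{Z}$, $\lambda$ is the Lebesgue probability measure on $\mathbb{S}^1$, $\Phi_d(x)=dx\bmod1$, and $\Phi_{d\#}$ denotes push-forward of measures by $\Phi_d$. ''Almost all $t$'' is with respect to Lebesgue measure. *)

(* Defs.v *)
From HB Require Import structures.
From mathcomp Require Import all_boot all_order all_algebra.
From mathcomp Require Import all_classical all_reals all_analysis.
From mathcomp Require Import measurable_realfun.
Import Order.TTheory GRing.Theory Num.Theory.
Import numFieldNormedType.Exports.

Set Implicit Arguments.
Unset Strict Implicit.
Unset Printing Implicit Defensive.

Local Open Scope classical_set_scope.
Local Open Scope ring_scope.

Section circle_def.
Variable R : realType.
Local Open Scope quotient_scope.

Definition eqmod1 (x y : R) : bool := x - y \is a Num.int.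

Let eqmod1_refl : reflexive eqmod1.
Proof. by move=> x; rewrite /eqmod1 subrr. Qed.

Let eqmod1_sym : symmetric eqmod1.
Proof. by move=> x y; rewrite /eqmod1 -(opprB x y) rpredN. Qed.

Let eqmod1_trans : transitive eqmod1.
Proof.
move=> y x z xy yz; rewrite /eqmod1 -(subrK y x) -addrA.
exact: rpredD.
Qed.

Canonical eqmod1_equiv := EquivRel eqmod1 eqmod1_refl eqmod1_sym eqmod1_trans.

Definition circle : Type := quotient_topology {eq_quot eqmod1_equiv}.

HB.instance Definition _ := PointedTopological.on circle.

Definition circle_proj (x : R) : circle :=
  \pi_(quotient_topology {eq_quot eqmod1_equiv}) x.

Definition circle_repr (x : circle) : R :=
  repr (x : quotient_topology {eq_quot eqmod1_equiv}).

Lemma circle_reprK : cancel circle_repr circle_proj.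
Proof. exact: (@reprK _ (quotient_topology {eq_quot eqmod1_equiv})). Qed.

Lemma eq_circle_proj (x y : R) :
  circle_proj x = circle_proj y <-> x - y \is a Num.int.
Proof.
split=> [|xy].
  by move/(eqmodP eqmod1_equiv).
exact/(eqmodP eqmod1_equiv).
Qed.

Lemma circle_proj_continuous : continuous circle_proj.
Proof. exact: pi_continuous. Qed.

Lemma circle_continuous (Z : topologicalType) (f : circle -> Z) :
  continuous f <-> continuous (f \o circle_proj).
Proof. exact: quotient_continuous. Qed.

(* The Borel sigma-algebra of the quotient topology. *)
HB.instance Definition _ := @isMeasurable.Build
  (sigma_display (@open circle)) circle <<s (@open circle) >>
  (@sigma_algebra0 _ setT (@open circle))
  (@sigma_algebraC circle (@open circle))
  (@sigma_algebra_bigcup _ setT (@open circle)).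

Lemma circle_measurableE :
  (measurable : set (set circle)) = <<s (@open circle) >>.
Proof. by []. Qed.

Lemma circle_proj_measurable : measurable_fun setT circle_proj.
Proof.
apply: (@measurability _ _ _ _ setT circle_proj (@open circle)) => //.
move=> _ [U oU <-]; rewrite setTI; apply: open_measurable.
by move/continuousP: circle_proj_continuous; exact.
Qed.

(* [circle_proj] with the Borel structure that [lebesgue_measure] lives on. *)
Definition borel_circle_proj : measurableTypeR R -> circle := circle_proj.

HB.instance Definition _ := isMeasurableFun.Build _ _
  (measurableTypeR R) circle borel_circle_proj circle_proj_measurable.

Definition circle_lebesgue : probability circle R :=
  distribution (uniform_prob (@ltr01 R)) borel_circle_proj.

(* The map x |-> d x mod 1; by [circle_mul_proj] it does not depend on the
   chosen representative. *)
Definition circle_mul (d : nat) (x : circle) : circle :=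
  circle_proj (d%:R * circle_repr x).

Lemma circle_mul_proj d x : circle_mul d (circle_proj x) = circle_proj (d%:R * x).
Proof.
apply/eq_circle_proj; rewrite -mulrBr; apply: rpredM; first exact: natr_int.
by apply/eq_circle_proj; exact: circle_reprK.
Qed.

Lemma circle_mul_continuous d : continuous (circle_mul d).
Proof.
apply/circle_continuous.
have -> : circle_mul d \o circle_proj = circle_proj \o ( *%R d%:R).
  by apply/funext => x /=; rewrite circle_mul_proj.
move=> x; apply: continuous_comp; last exact: circle_proj_continuous.
exact: mulrl_continuous.
Qed.

Lemma circle_mul_measurable d : measurable_fun setT (circle_mul d).
Proof.
apply: (@measurability _ _ _ _ setT (circle_mul d) (@open circle)) => //.
move=> _ [U oU <-]; rewrite setTI; apply: sub_sigma_algebra.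
by move/continuousP: (@circle_mul_continuous d); exact.
Qed.

HB.instance Definition _ d := isMeasurableFun.Build _ _ _ _ (circle_mul d)
  (@circle_mul_measurable d).

Definition circle_smooth (psi : circle -> R) : Prop :=
  forall (n : nat) (x : R), derivable (derive1n n (psi \o circle_proj)) x 1.

Definition atomless (P : probability circle R) : Prop :=
  forall x : circle, P [set x] = 0%E.

(* The circle is compact, so all continuous test functions are bounded. *)
Definition continuous_integrals (P : probability circle R) :
    {ptws continuousType circle R -> R} :=
  fun f => \int[P]_x f x.

(* Space of Borel probability measures on the circle with the weak topology:
   the coarsest one making P |-> \int f dP continuous for every continuous f. *)
Definition weak_probability : Type := initial_topology continuous_integrals.

HB.instance Definition _ := Topological.on weak_probability.

Lemma cvg_weak_probability (F : set_system weak_probability)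
    (FF : Filter F) (P : weak_probability) :
  F --> P <-> forall f : continuousType circle R,
    (fun Q : weak_probability => continuous_integrals Q f) @ F
      --> continuous_integrals P f.
Proof.
split=> [FP f|FP A].
  apply: (@cvg_comp _ _ _ continuous_integrals
    (fun g : {ptws continuousType circle R -> R} => g f) F
    (nbhs (continuous_integrals P))).
    exact: cvg_trans (cvg_app _ FP) (@initial_continuous _ _ _ P).
  exact: (@proj_continuous _ (fun _ : continuousType circle R => R) f).
rewrite nbhsE => -[_ [[B oB <-] BP] BA]; apply: (filterS BA).
suff : continuous_integrals @ F --> continuous_integrals P.
  by apply; exact: open_nbhs_nbhs.
apply/cvg_sup => f.
have evalT : (fun g : {ptws continuousType circle R -> R} => g f) @` setT = setT.
  by apply/seteqP; split=> // y _; exists (fun=> y).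
apply/cvg_image => // U /FP FU.
exists ((fun g : {ptws continuousType circle R -> R} => g f) @^-1` U) => //.
exact: image_preimage.
Qed.

End circle_def.

(* Main.v *)
(** If T is the derivative at 0 of such a path, invariance under all the maps
    x |-> d x forces the Fourier coefficients of T to satisfy c_{dk} = c_k, so
    that the even part of T is a multiple of delta_0 - lambda.
    The path realises T = delta_0 - lambda on both sides of t = 0: for t >= 0,
      mu_t = t Unif[0, t] + (1 - t) Unif[0, 1],
    and for t < 0, with s = -t,
      mu_t = s Unif[0, 1] + (1 - s) Unif[s, 1],
    so that relative to (1 - t) lambda a mass |t| is added (resp. removed) on
    the arc [0, |t|].
    Both are images of the uniform law on [0, 1] under a piecewise affine map,
    and in both cases the integral of f is (1 - t) int_0^1 f + P t - P 0 for P
    a primitive of x |-> f |x|, whence the derivative f 0 - int_0^1 f at 0.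
    Replacing f by x |-> f (d x) changes neither term. *)

From HB Require Import structures.
Require Import Defs.
From mathcomp Require Import all_boot all_order all_algebra.
From mathcomp Require Import all_classical all_reals all_analysis.
From mathcomp Require Import measurable_realfun ring lra.
Import Order.TTheory GRing.Theory Num.Theory.
Import numFieldNormedType.Exports.

Local Open Scope classical_set_scope.
Local Open Scope ring_scope.

(** * Calculus on segments of the real line *)

Lemma is_derive_continuous (R : realType) (f : R -> R) (x df : R) :
  is_derive x 1 f df -> {for x, continuous f}.
Proof. by move=> [d _]; apply/differentiable_continuous/derivable1_diffP. Qed.

Lemma continuous_integrable_itv (R : realType) (f : R -> R) (a b : R) :
  continuous f -> (@lebesgue_measure R).-integrable `[a, b] (EFin \o f).
Proof.
move=> cf; apply: continuous_compact_integrable; first exact: segment_compact.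
exact: continuous_subspaceT.
Qed.

Lemma Rintegral_primitive (R : realType) (f F : R -> R) (a b : R) :
  a <= b -> continuous f ->
  (forall x, x \in `[a, b] -> is_derive x 1 F (f x)) ->
  \int[lebesgue_measure]_(x in `[a, b]) f x = F b - F a.
Proof.
move=> ab cf dF; have cF x : x \in `[a, b] -> {for x, continuous F}.
  by move=> /dF; exact: is_derive_continuous.
move: ab; rewrite le_eqVlt => /predU1P[->|ab].
  by rewrite set_itv1 Rintegral_set1 subrr.
rewrite /Rintegral (continuous_FTC2 (F := F) ab) //.
- exact: continuous_subspaceT.
- split.
  + by move=> x /subset_itv_oo_cc /dF [].
  + by apply: cvg_at_right_filter; apply: cF; rewrite in_itv/= lexx ltW.
  + by apply: cvg_at_left_filter; apply: cF; rewrite in_itv/= lexx ltW.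
- by move=> x /subset_itv_oo_cc /dF dFx; rewrite derive1E derive_val.
Qed.

(** The primitive is the integral from [a], differentiated only to the right of [a]; each use
    therefore takes a base point strictly left of the points it needs. *)
Lemma exists_primitive (R : realType) (f : R -> R) (a : R) : continuous f ->
  exists F : R -> R, forall x, a < x -> is_derive x 1 F (f x).
Proof.
move=> cf; exists (fun x => \int[lebesgue_measure]_(t in `[a, x]) f t) => x ax.
have [||dF dFE] := @continuous_FTC1_closed R f a x (x + 1) _ _ ax (cf x).
- by rewrite ltrDl.
- exact: continuous_integrable_itv.
- by apply: DeriveDef => //; rewrite -derive1E.
Qed.

Lemma is_derive_affine (R : realType) (k m x : R) :
  is_derive x 1 (fun x => k * x + m) k.
Proof.
have : is_derive x 1 (k *: (@id R) + cst m) (k *: (1 : R) + 0) by apply: is_deriveD.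
by rewrite addr0 /GRing.scale/= mulr1.
Qed.

(** Both sides are F (k b + m) - F (k a + m) for a primitive F of [f]. Keeping the factor [k] on the
    left avoids any division. *)
Lemma Rintegral_affine (R : realType) (f : R -> R) (k m a b : R) :
  0 <= k -> a <= b -> continuous f ->
  k * \int[lebesgue_measure]_(x in `[a, b]) f (k * x + m) =
  \int[lebesgue_measure]_(x in `[k * a + m, k * b + m]) f x.
Proof.
move=> k0 ab cf.
have [F dF] := @exists_primitive R f (k * a + m - 1) cf.
have cfk : continuous (fun x => f (k * x + m)).
  move=> x; apply: continuous_comp; last exact: cf.
  exact: (is_derive_continuous _ _ _ _ (is_derive_affine _ k m x)).
rewrite -RintegralZl//; last exact: (@continuous_integrable_itv _ (fun x => f (k * x + m))).
transitivity (F (k * b + m) - F (k * a + m)); last first.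
  apply/esym; apply: Rintegral_primitive => //.
    by rewrite lerD2r ler_wpM2l.
  by move=> x; rewrite in_itv/= => /andP[ax _]; apply: dF; lra.
apply: (@Rintegral_primitive _ _ (fun x => F (k * x + m))) => //.
- by move=> x; apply: cvgM; [exact: cvg_cst|exact: cfk].
- move=> x; rewrite in_itv/= => /andP[ax xb].
  rewrite mulrC; apply: (@is_derive1_comp _ F (fun x => k * x + m)).
    by apply: dF; rewrite ltrBlDr ltr_pwDr// lerD2r ler_wpM2l.
  exact: is_derive_affine.
Qed.

Lemma Rintegral_itv_split (R : realType) (p q : R -> R) (a s b : R) :
  a <= s <= b -> continuous p -> continuous q ->
  \int[lebesgue_measure]_(x in `[a, b]) (if x < s then p x else q x) =
  \int[lebesgue_measure]_(x in `[a, s]) p x +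
  \int[lebesgue_measure]_(x in `[s, b]) q x.
Proof.
move=> /andP[as_ sb] cp cq.
have mp D : measurable D -> measurable_fun D (fun x => (p x)%:E).
  by move=> mD; apply/measurable_EFinP; apply: measurable_funTS;
    exact: continuous_measurable_fun.
have mq D : measurable D -> measurable_fun D (fun x => (q x)%:E).
  by move=> mD; apply/measurable_EFinP; apply: measurable_funTS;
    exact: continuous_measurable_fun.
(* The test [x < s] puts s in the [q] branch, so the left piece is half-open; closing it adds a null
   point. *)
have E1 : (\int[lebesgue_measure]_(x in `[a, s[) (if x < s then p x else q x)%:E =
          \int[lebesgue_measure]_(x in `[a, s]) (p x)%:E)%E.
  rewrite -integral_itv_bndo_bndc; last exact: mp.
  by apply: eq_integral => x; rewrite inE/= in_itv/= => /andP[_ ->].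
have E2 : (\int[lebesgue_measure]_(x in `[s, b]) (if x < s then p x else q x)%:E =
          \int[lebesgue_measure]_(x in `[s, b]) (q x)%:E)%E.
  by apply: eq_integral => x; rewrite inE/= in_itv/= ltNge => /andP[-> _].
rewrite /Rintegral -fineD//; last 2 first.
- by apply: integrable_fin_num => //; exact: continuous_integrable_itv.
- by apply: integrable_fin_num => //; exact: continuous_integrable_itv.
congr fine; rewrite -E1 -E2 -integral_setU//.
- congr (integral _ _ _).
  by rewrite -itv_bndbnd_setU// bnd_simp.
- apply/measurable_EFinP; apply: measurable_fun_if => //.
  + exact: measurableU.
  + by apply: measurable_fun_ltr.
  + by apply: measurable_funTS;
    exact: continuous_measurable_fun.
  + by apply: measurable_funTS;
    exact: continuous_measurable_fun.
- apply/disj_setPRL => x/=; rewrite !in_itv/= => /andP[sx _].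
  by apply/negP; rewrite ltNge sx andbF.
Qed.

(** * Change of variables for image measures *)

Lemma Rintegral_distribution d d' (T : measurableType d)
    (T' : measurableType d') (R : realType) (P : probability T R)
    (X : {RV P >-> T'}) (f : T' -> R) : measurable_fun setT f ->
  \int[distribution P X]_y f y = \int[P]_x f (X x).
Proof.
move=> mf; have mEf : measurable_fun setT (EFin \o f) by exact/measurable_EFinP.
(* For nonnegative functions the change of variables needs no integrability, so it is applied to the
   positive and negative parts separately. *)
congr fine; rewrite integralE [RHS]integralE.
congr (_ - _)%E; rewrite ge0_integral_distribution//.
- by rewrite -funepos_comp.
- exact: measurable_funepos.
- by rewrite -funeneg_comp.
- exact: measurable_funeneg.
Qed.

Lemma Rintegral_uniform01 (R : realType) (f : measurableTypeR R -> R) :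
  measurable_fun setT f ->
  \int[uniform_prob (@ltr01 R)]_x f x =
  \int[lebesgue_measure]_(x in `[0, 1]) f x.
Proof.
move=> mf; have mEf : measurable_fun setT (EFin \o f) by exact/measurable_EFinP.
congr fine; rewrite integralE [RHS]integralE !integral_uniform//;
  [|exact: measurable_funeneg|exact: measurable_funepos].
by rewrite subr0 invr1 !mul1e.
Qed.

Lemma continuous_circle_measurable (R : realType) (f : circle R -> R) :
  continuous f -> measurable_fun setT f.
Proof.
move=> /continuousP cf; apply: (measurability _ (RGenOpens.measurableE R)).
move=> _ [_ [a [b ->] <-]]; rewrite setTI; apply: sub_sigma_algebra.
exact/cf/interval_open.
Qed.

(** * The path of measures *)

Definition spread_left {R : realType} (t u : R) : R :=
  if t < 0 then u / - t else u.

Definition spread_right {R : realType} (t u : R) : R :=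
  if t < 0 then u else (u - t) / (1 - t).

(** One piece stays fixed while the other is stretched over the whole circle: the left one for t <
    0, the right one for t >= 0. The branches are separate functions because each is continuous on
    the whole line, as [Rintegral_itv_split] requires, whereas [spread t] jumps at |t| when 0 < |t|
    < 1. *)
Definition spread {R : realType} (t u : R) : R :=
  if u < `|t| then spread_left t u else spread_right t u.

Lemma spread_left_continuous (R : realType) (t : R) : continuous (spread_left t).
Proof.
rewrite /spread_left; case: ltP => _ x; last exact: cvg_id.
by apply: cvgM; [exact: cvg_id|exact: cvg_cst].
Qed.

Lemma spread_right_continuous (R : realType) (t : R) : continuous (spread_right t).
Proof.
rewrite /spread_right; case: ltP => _ x; first exact: cvg_id.
by apply: cvgM; [apply: cvgB; [exact: cvg_id|exact: cvg_cst]|exact: cvg_cst].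
Qed.

Lemma spread0 (R : realType) (u : R) : spread 0 u = u.
Proof.
by rewrite /spread /spread_left /spread_right ltxx subr0 subr0 divr1; case: ifP.
Qed.

Lemma spread_measurable (R : realType) (t : R) : measurable_fun setT (spread t).
Proof.
apply: measurable_fun_ifT; first exact: measurable_fun_ltr.
- by apply: continuous_measurable_fun; exact: spread_left_continuous.
- by apply: continuous_measurable_fun; exact: spread_right_continuous.
Qed.

Definition spread_circle {R : realType} (t : R) : measurableTypeR R -> circle R :=
  fun u => circle_proj (spread t u).

Lemma spread_circle_measurable (R : realType) (t : R) :
  measurable_fun setT (spread_circle t).
Proof.
apply: (@measurableT_comp _ _ _ _ _ _ (@circle_proj R)).
  exact: circle_proj_measurable.
exact: spread_measurable.
Qed.

HB.instance Definition _ (R : realType) (t : R) := isMeasurableFun.Build _ _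
  (measurableTypeR R) (circle R) (spread_circle t) (spread_circle_measurable R t).

(** Being an image of a single probability measure, this is a probability measure for every real t;
    it is the intended mixture when |t| < 1. *)
Definition concentration {R : realType} (t : R) : probability (circle R) R :=
  distribution (uniform_prob (@ltr01 R)) (spread_circle t).

(** * Integrals along the path, their derivatives and weak continuity *)

Lemma Rintegral_concentration (R : realType) (t : R) (f : circle R -> R) :
  `|t| < 1 -> continuous f ->
  \int[concentration t]_x f x =
  \int[lebesgue_measure]_(x in `[0, `|t|]) f (circle_proj (spread_left t x)) +
  \int[lebesgue_measure]_(x in `[`|t|, 1]) f (circle_proj (spread_right t x)).
Proof.
move=> t1 cf; have mf := continuous_circle_measurable _ _ cf.
have cp p : continuous p -> continuous (fun x : R => f (circle_proj (p x))).
  move=> cp x; apply: continuous_comp; last exact: cf.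
  apply: continuous_comp; [exact: cp|exact: circle_proj_continuous].
rewrite Rintegral_distribution// Rintegral_uniform01; last first.
  by apply: (measurableT_comp mf); exact: spread_circle_measurable.
rewrite -Rintegral_itv_split ?normr_ge0 ?ltW//; last 2 first.
- by apply: cp; exact: spread_left_continuous.
- by apply: cp; exact: spread_right_continuous.
apply: eq_Rintegral => x _.
transitivity (f (circle_proj (spread t x))) => //.
by rewrite /spread; case: (x < _).
Qed.

(** Integrating the even function x |-> f |x| from 0 to a negative t gives minus the integral of [f]
    over the arc [0, |t|]. Hence mass added for t > 0 and mass removed for t < 0 both appear as P t
    - P 0, and no case distinction is left when differentiating at 0. *)
Lemma Rintegral_concentration_primitive (R : realType) (f : circle R -> R) :
  continuous f ->
  exists P : R -> R,
    (forall x : R, -1 < x -> is_derive x 1 P (f (circle_proj `|x|))) /\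
    forall t : R, `|t| < 1 -> \int[concentration t]_x f x =
      (1 - t) * \int[lebesgue_measure]_(x in `[0, 1]) f (circle_proj x) +
      (P t - P 0).
Proof.
move=> cf; pose g x := f (circle_proj x).
have cg : continuous g by exact/circle_continuous.
have cga : continuous (fun x : R => g `|x|).
  move=> x; apply: (@continuous_comp _ _ _ (fun y : R => `|y|) g).
    exact: norm_continuous.
  exact: cg.
have [P dP] := exists_primitive _ (fun x : R => g `|x|) (-1) cga.
exists P; split=> // t t1; rewrite Rintegral_concentration//.
rewrite /spread_left /spread_right; have [t0|t0] := ltP t 0.
- have -> : \int[lebesgue_measure]_(x in `[0, `|t|]) f (circle_proj (x / - t)) =
      - t * \int[lebesgue_measure]_(x in `[0, 1]) g x.
    have := @Rintegral_affine R g (- t)^-1 0 0 (- t).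
    rewrite mulr0 mulVf ?oppr_eq0 ?lt_eqF// !addr0 ltr0_norm// => <-//; try lra.
      rewrite mulrA mulfV ?mul1r ?oppr_eq0 ?lt_eqF//.
      by apply: eq_Rintegral => x _; rewrite addr0 mulrC.
    by rewrite invr_ge0; lra.
  (* The fixed arc [|t|, 1] is the whole circle minus the arc [0, |t|]. *)
  have -> : \int[lebesgue_measure]_(x in `[0, 1]) f (circle_proj x) =
    \int[lebesgue_measure]_(x in `[0, `|t|]) g x +
    \int[lebesgue_measure]_(x in `[`|t|, 1]) g x.
    rewrite -Rintegral_itv_split ?normr_ge0 ?ltW//.
    by apply: eq_Rintegral => x _; case: ifP.
  have -> : \int[lebesgue_measure]_(x in `[0, `|t|]) g x = P 0 - P t.
    transitivity (- P (- `|t|) - - P (- 0)); last by rewrite ltr0_norm// opprK oppr0 addrC opprK.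
    (* By evenness, the reflected function x |-> - P (- x) is again a primitive of [g] on
       [0, |t|]. *)
    apply: (@Rintegral_primitive _ _ (fun x => - P (- x))) => // x.
    rewrite in_itv/= => /andP[x0 xt].
    have dPx : is_derive (- x) 1 P (g x).
      by have := dP (- x); rewrite normrN ger0_norm//; apply; lra.
    have dPN : is_derive x 1 (P \o -%R) (g x * -1) by apply: is_derive1_comp.
    have : is_derive x 1 (- (P \o -%R)) (- (g x * -1)) by apply: is_deriveN.
    by rewrite mulrN1 opprK.
  rewrite -/g; ring.
- have -> : \int[lebesgue_measure]_(x in `[`|t|, 1]) f (circle_proj ((x - t) / (1 - t))) =
      (1 - t) * \int[lebesgue_measure]_(x in `[0, 1]) g x.
    have t1' : 1 - t != 0 by rewrite subr_eq0 gt_eqF// -(ger0_norm t0).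
    have ct : continuous (fun x => g ((x - t) / (1 - t))).
      move=> x; apply: continuous_comp; last exact: cg.
      by apply: cvgM; [apply: cvgB; [exact: cvg_id|exact: cvg_cst]|exact: cvg_cst].
    have := Rintegral_affine _ _ (1 - t) t 0 1 _ _ ct.
    rewrite mulr0 add0r mulr1 subrK ger0_norm// => <-//; last first.
      by rewrite subr_ge0 -(ger0_norm t0) ltW.
    congr (_ * _); apply: eq_Rintegral => x _.
    by rewrite addrK mulrC mulKf.
  have -> : \int[lebesgue_measure]_(x in `[0, `|t|]) f (circle_proj x) = P t - P 0.
    rewrite ger0_norm//; apply: Rintegral_primitive => // x.
    rewrite in_itv/= => /andP[x0 xt].
    by have := dP x; rewrite ger0_norm//; apply; lra.
  by rewrite addrC.
Qed.

(** Proved at every |t| < 1 and not only at 0, since differentiability against each continuous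
    function also yields weak continuity of the path. *)
Lemma is_derive_Rintegral_concentration (R : realType) (f : circle R -> R) (t : R) :
  `|t| < 1 -> continuous f ->
  is_derive t 1 (fun s => \int[concentration s]_x f x)
    (f (circle_proj `|t|) -
     \int[lebesgue_measure]_(x in `[0, 1]) f (circle_proj x)).
Proof.
move=> t1 cf; set I := \int[_]_(_ in _) _.
have [P [dP PE]] := Rintegral_concentration_primitive _ _ cf.
have dPt : is_derive t 1 P (f (circle_proj `|t|)).
  by apply: dP; move: t1; rewrite ltr_norml => /andP[].
apply: (@near_eq_is_derive _ _ _ ((fun s => - I * s + (I - P 0)) + P)).
  have : \forall s \near t, s \in `]-1, 1[.
    by apply: near_in_itvoo; rewrite in_itv/= -ltr_norml.
  apply: filterS => s; rewrite in_itv/= -ltr_norml => s1.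
  rewrite PE// -/I fctE; ring.
rewrite addrC; apply: is_deriveD; exact: is_derive_affine.
Qed.

Lemma concentration_continuous (R : realType) (t : R) : `|t| < 1 ->
  {for t, continuous (concentration : R -> weak_probability R)}.
Proof.
move=> t1; apply/cvg_weak_probability => f.
exact: (is_derive_continuous _ _ _ _
  (is_derive_Rintegral_concentration _ f t t1 (@cts_fun _ _ f))).
Qed.

Lemma concentration0 (R : realType) (A : set (circle R)) :
  concentration 0 A = circle_lebesgue R A.
Proof.
have /funext E : @spread_circle R 0 =1 @circle_proj R.
  by move=> u; rewrite /spread_circle spread0.
by rewrite /concentration /circle_lebesgue /distribution /pushforward/= E.
Qed.

(** * Absence of atoms *)

Lemma countable_preimage_inj (T U : Type) (f : T -> U) (B : set U) :
  injective f -> countable B -> countable (f @^-1` B).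
Proof.
by move=> fi; apply: sub_countable; apply: card_ge_preimage => x y _ _; exact: fi.
Qed.

Lemma countable_circle_fiber (R : realType) (x : circle R) :
  countable (@circle_proj R @^-1` [set x]).
Proof.
apply: (@sub_countable _ _ _ (range (fun m : int => circle_repr x + m%:~R))).
  apply: subset_card_le => y /= yx.
  have /eq_circle_proj/intrP[m mE] : circle_proj y = circle_proj (circle_repr x).
    by rewrite circle_reprK.
  by exists m => //; rewrite -mE addrC subrK.
exact: sub_countable (card_image_le _ _) (countableP _).
Qed.

(** Both affine branches have nonzero slope, hence are injective, and [circle_proj] has countable
    fibres. The preimage of a point is thus countable, so null for the uniform law. *)
Lemma concentration_atomless (R : realType) (t : R) : `|t| < 1 ->
  atomless (concentration t).
Proof.
move=> t1 x.
have t1' : 1 - t != 0 by rewrite subr_eq0 gt_eqF// (le_lt_trans (ler_norm t)).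
pose C := @circle_proj R @^-1` [set x].
have cS : countable (@spread_circle R t @^-1` [set x]).
  apply: (@sub_countable _ _ _ (\bigcup_(b in [set: bool])
      ((if b then spread_left t else spread_right t) @^-1` C))).
    apply: subset_card_le => u; rewrite /spread_circle /spread/= => Cu.
    by exists (u < `|t|) => //; move: Cu; case: (u < _).
  apply: bigcup_countable => [|b _]; first exact: countableP.
  apply: countable_preimage_inj; last exact: countable_circle_fiber.
  case: b.
    rewrite /spread_left; have [t0|t0 u v //] := ltP t 0.
    by move=> u v; apply: mulIf; rewrite invr_eq0 oppr_eq0 lt_eqF.
  rewrite /spread_right; have [t0 u v //|t0] := ltP t 0.
  move=> u v E; apply: (@addIr _ (- t)); move: E.
  by apply: mulIf; rewrite invr_eq0.
have mS : measurable (@spread_circle R t @^-1` [set x]).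
  by apply: countable_measurable cS => u; exact: measurable_set1.
have /null_content_dominatesP := @dominates_uniform_prob R 0 1 ltr01.
apply => //.
exact: countable_lebesgue_measure0.
Qed.

(** * Periodic functions and the scaling x |-> d x *)

Lemma Rintegral_periodic (R : realType) (f : R -> R) (d : nat) :
  continuous f -> periodic f 1 ->
  \int[lebesgue_measure]_(x in `[0, d%:R]) f x =
  d%:R * \int[lebesgue_measure]_(x in `[0, 1]) f x.
Proof.
move=> cf f1; elim: d => [|d IHd].
  by rewrite mul0r set_itv1 Rintegral_set1.
(* The test with equal branches creates a breakpoint at d for [Rintegral_itv_split]. *)
transitivity (\int[lebesgue_measure]_(x in `[0, d.+1%:R])
    (if x < d%:R then f x else f x)).
  by apply: eq_Rintegral => x _; case: ifP.
rewrite Rintegral_itv_split// ?ler_nat ?ler0n ?leqnSn// IHd.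
rewrite -natr1 mulrDl mul1r; congr (_ + _).
have := Rintegral_affine _ _ 1 d%:R 0 1 ler01 ler01 cf.
rewrite mulr0 mulr1 mul1r add0r [1 + _]addrC => <-.
apply: eq_Rintegral => x _.
by rewrite mul1r (periodicn f1).
Qed.

(** The substitution y = d x covers d periods with weight 1/d. On the circle this is the invariance
    of Lebesgue measure under [circle_mul d]. *)
Lemma Rintegral_periodic_scale (R : realType) (f : R -> R) (d : nat) :
  (0 < d)%N -> continuous f -> periodic f 1 ->
  \int[lebesgue_measure]_(x in `[0, 1]) f (d%:R * x) =
  \int[lebesgue_measure]_(x in `[0, 1]) f x.
Proof.
move=> d0 cf f1; apply: (@mulfI _ d%:R); first by rewrite pnatr_eq0 -lt0n.
rewrite -(Rintegral_periodic _ f)//.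
have := Rintegral_affine _ _ d%:R 0 0 1 (ler0n _ _) ler01 cf.
rewrite mulr0 mulr1 !addr0 => <-; congr (_ * _).
by apply: eq_Rintegral => x _; rewrite addr0.
Qed.

Lemma circle_proj_periodic (R : realType) (T : zmodType) (f : circle R -> T) :
  periodic (f \o @circle_proj R) 1.
Proof.
move=> x /=; congr f; apply/eq_circle_proj.
by rewrite addrAC subrr add0r; exact: (intr_int _ 1).
Qed.

Lemma circle_smooth_continuous (R : realType) (f : circle R -> R) :
  circle_smooth f -> continuous f.
Proof.
move=> sf; apply/circle_continuous => x.
exact/differentiable_continuous/derivable1_diffP/(sf 0%N x).
Qed.

(** * A smooth test function with nonzero derivative along the path *)

Lemma is_derive_cos_sin (R : realType) (w a b x : R) :
  is_derive x 1 (fun x => a * cos (w * x) + b * sin (w * x))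
    ((b * w) * cos (w * x) + (- (a * w)) * sin (w * x)).
Proof.
have dw : is_derive x 1 ( *%R w) w.
  have := is_derive_affine _ w 0 x.
  by apply: near_eq_is_derive; near=> y; rewrite addr0.
have dc : is_derive x 1 (@cos R \o *%R w) (- sin (w * x) * w).
  exact: is_derive1_comp.
have ds : is_derive x 1 (@sin R \o *%R w) (cos (w * x) * w).
  exact: is_derive1_comp.
have : is_derive x 1 (a *: (@cos R \o *%R w) + b *: (@sin R \o *%R w))
   (a *: (- sin (w * x) * w) + b *: (cos (w * x) * w)).
  by apply: is_deriveD.
move=> H; apply: (is_derive_eq H); rewrite /GRing.scale/=; ring.
Unshelve. all: end_near. Qed.

(** The span of cos (w x) and sin (w x) is stable under differentiation, so the induction needs no
    explicit coefficients. *)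
Lemma derive1n_cos_sin (R : realType) (w a b : R) (n : nat) :
  exists a' b', derive1n n (fun x : R => a * cos (w * x) + b * sin (w * x)) =
    (fun x => a' * cos (w * x) + b' * sin (w * x)).
Proof.
elim: n => [|n [a' [b' E]]]; first by exists a, b.
exists (b' * w), (- (a' * w)).
rewrite derive1nS E; apply/funext => x.
have [_ <-] := is_derive_cos_sin _ w a' b' x.
by rewrite derive1E.
Qed.

(** It has value 1 at the point 0 and mean 0, so the derivative formula gives 1. *)
Definition circle_cos {R : realType} (x : circle R) : R :=
  cos (pi *+ 2 * circle_repr x).

Lemma circle_cos_proj (R : realType) (x : R) :
  circle_cos (circle_proj x) = cos (pi *+ 2 * x).
Proof.
rewrite /circle_cos; set y := circle_repr _.
have /eq_circle_proj/intrP[m mE] : circle_proj y = circle_proj x.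
  by rewrite circle_reprK.
have -> : y = x + m%:~R by rewrite -mE addrC subrK.
have cosn (n : nat) z : cos (pi *+ 2 * (z + n%:R)) = cos (pi *+ 2 * z) :> R.
  by rewrite mulrDr mulr_natr (periodicn (@cosD2pi R)).
case: m {mE} => n; first by rewrite -pmulrn cosn.
(* Here m = - (n + 1), and adding n + 1 periods cancels it. *)
by rewrite -(cosn n.+1) NegzE rmorphN/= subrK.
Qed.

Lemma circle_cos_smooth (R : realType) : circle_smooth (@circle_cos R).
Proof.
move=> n x.
have -> : @circle_cos R \o @circle_proj R =
    (fun x => 1 * cos (pi *+ 2 * x) + 0 * sin (pi *+ 2 * x)).
  by apply/funext => y /=; rewrite circle_cos_proj mul1r mul0r addr0.
have [a [b ->]] := derive1n_cos_sin _ (pi *+ 2 : R) 1 0 n.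
by have [] := is_derive_cos_sin _ (pi *+ 2) a b x.
Qed.

Lemma Rintegral_circle_cos (R : realType) :
  \int[lebesgue_measure]_(x in `[0, 1]) circle_cos (circle_proj x) = 0 :> R.
Proof.
have pi0 : pi *+ 2 != 0 :> R by rewrite mulrn_eq0/= gt_eqF// pi_gt0.
pose F (x : R) := 0 * cos (pi *+ 2 * x) + (pi *+ 2)^-1 * sin (pi *+ 2 * x).
transitivity (F 1 - F 0); last first.
  by rewrite /F !mul0r !add0r mulr0 mulr1 sin0 sin2pi subrr.
apply: Rintegral_primitive => // [|x _].
  by apply/circle_continuous/circle_smooth_continuous/circle_cos_smooth.
have := is_derive_cos_sin _ (pi *+ 2) 0 (pi *+ 2)^-1 x.
by rewrite circle_cos_proj mulVf// mul1r mul0r oppr0 mul0r addr0.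
Qed.

Theorem corollary1p8 (R : realType) :
  exists (e : R) (mu : R -> probability (circle R) R),
    [/\ 0 < e,
        forall A : set (circle R), measurable A ->
          mu 0 A = circle_lebesgue R A,
        {within `]- e, e[, continuous (mu : R -> weak_probability R)},
        {ae @lebesgue_measure R, forall t : R, t \in `]- e, e[ ->
          atomless (mu t)} &
        (exists psi0 : circle R -> R,
          [/\ circle_smooth psi0,
              derivable (fun t : R => \int[mu t]_x psi0 x) 0 1 &
              (fun t : R => \int[mu t]_x psi0 x)^`()%classic 0 != 0])
        /\
        (forall psi : circle R -> R, circle_smooth psi ->
         forall d : nat, (2 <= d)%N ->
          [/\ derivable (fun t : R => \int[mu t]_x psi x) 0 1,
              derivable (fun t : R =>
                \int[distribution (mu t) (circle_mul d)]_x psi x) 0 1 &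
              (fun t : R => \int[mu t]_x psi x)^`()%classic 0 =
              (fun t : R =>
                \int[distribution (mu t) (circle_mul d)]_x psi x)^`()%classic 0])].
Proof.
have lt01 : `|0 : R| < 1 by rewrite normr0 ltr01.
exists 1, concentration; split.
- exact: ltr01.
- by move=> A _; exact: concentration0.
- apply: continuous_in_subspaceT => t; rewrite inE/= in_itv/= -ltr_norml.
  exact: concentration_continuous.
- by apply: aeW => t; rewrite in_itv/= -ltr_norml; exact: concentration_atomless.
- split.
    exists circle_cos; have sc := circle_cos_smooth R.
    have [dc dcE] := is_derive_Rintegral_concentration _ _ _ lt01
      (circle_smooth_continuous _ _ sc).
    split=> //; rewrite derive1E dcE Rintegral_circle_cos circle_cos_proj.
    by rewrite normr0 mulr0 cos0 subr0 oner_neq0.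
  move=> psi /circle_smooth_continuous cpsi d d2.
  have cpsid : continuous (psi \o circle_mul d).
    by move=> x; apply: continuous_comp; [exact: circle_mul_continuous|exact: cpsi].
  have [dp dpE] := is_derive_Rintegral_concentration _ _ _ lt01 cpsi.
  (* The push-forward is moved onto the test function, so the same derivative formula serves both
     paths. *)
  have -> : (fun t : R => \int[distribution (concentration t) (circle_mul d)]_x psi x) =
            (fun t => \int[concentration t]_x (psi \o circle_mul d) x).
    apply/funext => t; rewrite Rintegral_distribution//.
    exact: continuous_circle_measurable.
  have [dq dqE] := is_derive_Rintegral_concentration _ _ _ lt01 cpsid.
  (* The values at 0 agree because [circle_mul d] fixes the point 0; the means agree by invariance
     of Lebesgue measure. *)
  split=> //; rewrite !derive1E dpE dqE normr0 /= circle_mul_proj mulr0.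
  congr (_ - _); apply/esym.
  under eq_Rintegral do rewrite circle_mul_proj.
  apply: (@Rintegral_periodic_scale _ (psi \o @circle_proj R)).
  + exact: leq_trans d2.
  + exact/circle_continuous.
  + exact: circle_proj_periodic.
Qed.
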